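(* Let $n\ge 3$, let $T\in V(\mathcal G_n)$ be a spanning tree of $K_n$ and let $c\in V(T)=[n]$. Then the following are equivalent. (1) $c$ is a centroid of $T$. (2) $\Psi(T)=d_{\mathcal G_n}(T,s_c)=\Phi_c(T)$. (3) $s_c$ has minimal distance from $T$ in $\mathcal G_n$ among all star trees.
   Context: The network realignment graph $\mathcal G_n$ has as vertices all labelled trees on $[n]=\{1,\dots,n\}$. Two trees are adjacent if they differ by a single leaf slide: $T_2$ is obtained from $T_1$ by choosing a leaf $v$ of $T_1$ with neighbour $u$ and a neighbour $w\ne v$ of $u$ in $T_1$, deleting the edge $(v,u)$ and inserting the edge $(v,w)$. $d_{\mathcal G_n}$ is the graph distance. For $c\in[n]$, $s_c$ is the star tree in which all other vertices are adjacent to $c$; the star trees are $s_1,\dots,s_n$. For a tree $T$ on $[n]$ and $c\in[n]$, $\Phi_c(T)=\sum_{x\in V(T)\setminus\{c\}}(d_T(x,c)-1)$, where $d_T$ is the distance in $T$. For an edge $e$ of $T$, let $A_e,B_e$ be the two components of $T\setminus\{e\}$ and $\sigma_T(e)=\min(|V(A_e)|,|V(B_e)|)$; set $\Psi(T)=\sum_{e\in E(T)}(\sigma_T(e)-1)$. A vertex $c$ of a tree $T$ with $n$ vertices is a centroid if all connected components of $T\setminus\{c\}$ have at most $n/2$ vertices. *)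

(* Defs.v *)
From HB Require Import structures.
From mathcomp Require Import all_boot.

Set Implicit Arguments.
Unset Strict Implicit.
Unset Printing Implicit Defensive.

(* Length of a shortest e-path from x to y. Shortest paths have fewer than    *)
(* #|V| edges, so bounding the search loses nothing; if y is not reachable    *)
(* from x, the value is #|V|.                                                 *)
Definition gdist (V : finType) (e : rel V) (x y : V) : nat :=
  find (fun k => [exists p : k.-tuple V, path e x p && (last x p == y)])
       (iota 0 #|V|).

(* Vertex sets of the connected components of the subgraph induced on D. *)
Definition components (V : finType) (e : rel V) (D : {set V}) : {set {set V}} :=
  equivalence_partition
    (connect [rel x y | [&& x \in D, y \in D & e x y]]) D.

Section LabelledTrees.
Variable n : nat.
Implicit Types (E : {set {set 'I_n}}) (c x y : 'I_n).

(* A graph on the n labels is given by its set of edges {x, y}. *)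
Definition adj E : rel 'I_n := [rel x y | [set x; y] \in E].

Definition simple_graph E : bool := [forall e in E, #|e| == 2].

Definition connected_graph E : bool := [forall x, forall y, connect (adj E) x y].

(* A cycle is a closed walk through k >= 3 distinct vertices, so k <= n. *)
Definition acyclic_graph E : bool :=
  [forall k : 'I_n.+1, forall p : k.-tuple 'I_n,
     ucycleb (adj E) p ==> (k <= 2)].

Definition is_tree E : bool :=
  [&& simple_graph E, connected_graph E & acyclic_graph E].

Record tree := Tree { edges :> {set {set 'I_n}}; _ : is_tree edges }.

HB.instance Definition _ := [isSub for edges].
HB.instance Definition _ := [Finite of tree by <:].

Implicit Type T : tree.

Definition leaf E x : bool := #|[set y | adj E x y]| == 1.

Definition leaf_slide : rel tree := fun T1 T2 =>
  [exists v, exists u, exists w,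
    [&& leaf T1 v, adj T1 v u, adj T1 u w, w != v &
        edges T2 == [set v; w] |: (edges T1 :\ [set v; u])]].

Definition star_edges c : {set {set 'I_n}} := [set [set c; x] | x in [set~ c]].

Lemma adj_star c x y :
  adj (star_edges c) x y = (x != y) && ((x == c) || (y == c)).
Proof.
apply/imsetP/andP => [[z] | [xy]].
  rewrite !inE => zc eq_xy.
  have := set21 x y; have := set22 x y; rewrite eq_xy !inE.
  have := set21 c z; rewrite -eq_xy !inE ![c == _]eq_sym => cxy.
  split; last by [].
  apply: contraNneq zc => exy; have := set22 c z.
  by rewrite -eq_xy !inE exy orbb => /eqP ->; rewrite exy orbb in cxy.
case/orP=> /eqP ec; rewrite -ec.
  by exists y; rewrite ?inE -?ec // eq_sym.
by exists x; rewrite ?inE -?ec // setUC.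
Qed.

Lemma star_is_tree c : is_tree (star_edges c).
Proof.
apply/and3P; split.
- apply/forallP=> e; apply/implyP=> /imsetP[x].
  by rewrite !inE => xc ->; rewrite cards2 [c == x]eq_sym xc.
- have toc x : connect (adj (star_edges c)) x c.
    have [-> | xc] := eqVneq x c; first exact: connect0.
    by apply: connect1; rewrite adj_star xc eqxx orbT.
  have ofc x : connect (adj (star_edges c)) c x.
    have [-> | xc] := eqVneq x c; first exact: connect0.
    by apply: connect1; rewrite adj_star eq_sym xc eqxx.
  by apply/forallP=> x; apply/forallP=> y; apply: connect_trans (toc x) (ofc y).
- apply/forallP=> k; apply/forallP=> p; apply/implyP=> /andP[cyc Up].
  rewrite -(size_tuple p).
  case: (tval p) cyc Up => [|a [|b [|d [|e s]]]] //=.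
    rewrite !adj_star !inE !negb_or => /and4P[/andP[_ h1] /andP[_ h2] /andP[_ h3] _].
    move=> /and3P[/andP[ab ad] bd _].
    case/orP: h1 => /eqP h; subst c.
      by move: h2; rewrite ![_ == a]eq_sym (negPf ab) (negPf ad).
    by move: h3; rewrite (negPf ab) [d == b]eq_sym (negPf bd).
  rewrite !adj_star !inE !negb_or.
  move=> /and4P[/andP[_ h1] /andP[_ h2] /andP[_ h3] _].
  move=> /and3P[/and4P[ab ad ae _] /and3P[bd be _] _].
  case/orP: h1 => /eqP h; subst c.
    by move: h2; rewrite ![_ == a]eq_sym (negPf ab) (negPf ad).
  by move: h3; rewrite ![_ == b]eq_sym (negPf bd) (negPf be).
Qed.

Definition star c : tree := Tree (star_is_tree c).

Definition Phi c T : nat := \sum_(x | x != c) (gdist (adj T) x c - 1).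

(* The default value n of the minimum is harmless, since #|A| <= n. *)
Definition sigma T (e : {set 'I_n}) : nat :=
  \big[minn/n]_(A in components (adj (edges T :\ e)) setT) #|A|.

Definition Psi T : nat := \sum_(e in edges T) (sigma T e - 1).

Definition centroid T c : bool :=
  [forall A in components (adj T) [set~ c], 2 * #|A| <= n].

End LabelledTrees.

(* Main.v *)
Require Import Defs.
From HB Require Import structures.
From mathcomp Require Import all_boot zify.

Set Implicit Arguments.
Unset Strict Implicit.
Unset Printing Implicit Defensive.

(** Root [T] at [c] and let [p] be the parent map. An edge [{x, p x}] separates the
    branch [D x] of vertices below [x] from the rest, so it contributes
    [min (#|D x|, n - #|D x|) - 1] to [Psi T]. Counting the pairs of a vertex and
    one of its non-root ancestors in two ways shows that it contributes
    [#|D x| - 1] to [Phi c T]. Hence [Psi T <= Phi c T], with equality exactly when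
    every branch has at most [n / 2] vertices, which says that [c] is a centroid
    ([sigma_rooted], [Phi_rooted], [Phi_le_PsiP], [centroidP]).

    Equality also occurs for some [c]: when a branch at a child [t] of [c] has more
    than [n / 2] vertices, moving the root to [t] makes [Phi] smaller, so a
    minimiser of [Phi] over all roots is a centroid ([exists_Phi_le_Psi]). A leaf is
    never a centroid when [n >= 3] ([leaf_Psi_lt_Phi]).

    Sliding a leaf [v] changes [Phi c] by at most one if [c != v]
    ([leaf_slideP]). Applied to a centroid [c] of the new tree, which cannot be the
    slid leaf, this shows that [Psi] drops by at most one along a slide
    ([Psi_slide]). As [Psi] is zero on stars, [Psi T] bounds the distance from [T]
    to every star from below. In the other direction, sliding a deepest leaf
    towards [c] lowers [Phi c] by one until the star at [c] is reached, so that
    distance is at most [Phi c T]. Thus a centroid satisfies (2), and (2) implies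
    (3).

    For (3) => (1), existence of a centroid gives a path of length at most [Psi T]
    from [T] to the star at [c]. Going back along it from the star, the length
    bound forces [c] to be a centroid of each tree met; so [c] is never the slid
    leaf, and [Phi c] grows by at most one per step ([Phi_le_short_path]). At the
    end [Phi c T <= Psi T], so [c] is a centroid of [T]. *)

(** * Distances in finite graphs *)

Section GraphDistance.
Variables (V : finType) (e : rel V).
Implicit Types (x y c : V) (f : V -> nat).

Lemma gdist_le_size x y p : path e x p -> last x p = y -> gdist e x y <= size p.
Proof.
move=> ep lp; rewrite leqNgt; apply/negP=> lt_p.
have := before_find 0 lt_p.
have szV : size p < #|V|.
  by apply: leq_trans lt_p _; rewrite (leq_trans (find_size _ _)) ?size_iota.
rewrite nth_iota // add0n /= => /negbT/negP[]; apply/existsP.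
by exists (in_tuple p); rewrite /= ep lp eqxx.
Qed.

Lemma gdist_path x y : connect e x y ->
  exists p, [/\ path e x p, last x p = y & size p = gdist e x y].
Proof.
case/connectP=> p0 /shortenP[p ep Up _] ->{p0}; set y' := last x p.
have szV : size p < #|V|.
  by have /card_uniqP /= <- := Up; apply: max_card.
have has_k : has (fun k => [exists q : k.-tuple V, path e x q && (last x q == y')])
                 (iota 0 #|V|).
  apply/hasP; exists (size p); first by rewrite mem_iota.
  by apply/existsP; exists (in_tuple p); rewrite /= ep eqxx.
have := nth_find 0 has_k; rewrite nth_iota ?add0n; last first.
  by rewrite -[X in _ < X](size_iota 0) -has_find.
case/existsP=> q /andP[eq /eqP lq]; exists q; split=> //.
by rewrite size_tuple.
Qed.

Lemma gdistxx x : gdist e x x = 0.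
Proof. by apply/eqP; rewrite -leqn0 (@gdist_le_size x x [::]). Qed.

Lemma gdist_step x y : connect e x y -> x != y ->
  exists2 z, e x z & gdist e x y = (gdist e z y).+1.
Proof.
case/gdist_path=> -[|z p] /= [ep lp sz] xy; first by rewrite lp eqxx in xy.
case/andP: ep => exz ep; exists z => //.
have zy: connect e z y by apply/connectP; exists p.
apply/eqP; rewrite eqn_leq -{2}sz ltnS gdist_le_size // andbT.
case: (gdist_path zy) => q [eq lq <-].
by apply: (@gdist_le_size x y (z :: q)); rewrite /= ?exz.
Qed.

(** A potential dropping by at most one along each edge bounds distances from
    below. *)
Lemma path_potential f x p :
  (forall y z, e y z -> f y <= (f z).+1) -> path e x p ->
  f x <= f (last x p) + size p.
Proof.
move=> fe; elim: p x => [|y p IHp] x /=; first by rewrite addn0.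
by case/andP=> /fe fxy /IHp; lia.
Qed.

(** A potential that can always be decreased by one, until [c] is reached, bounds
    distances from above. *)
Lemma gdist_descent f c :
  (forall x, x != c -> exists2 y, e x y & f x = (f y).+1) ->
  forall x, connect e x c /\ gdist e x c <= f x.
Proof.
move=> fe x; have [k] := ubnP (f x); elim: k x => // k IHk x ltfk.
have [->|xc] := eqVneq x c; first by rewrite gdistxx connect0.
have [y exy fxy] := fe x xc; have [|cyc le_yc] := IHk y; first by lia.
split; first exact: connect_trans (connect1 exy) cyc.
case: (gdist_path cyc) => q [eq lq szq].
by apply: leq_trans (@gdist_le_size x c (y :: q) _ _) _; rewrite /= ?exy //; lia.
Qed.

End GraphDistance.

(** * Rooted trees *)

Lemma adj_sym n (E : {set {set 'I_n}}) : symmetric (adj E).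
Proof. by move=> x y; rewrite /adj /= setUC. Qed.

(** A tree is handled through the map [p] sending each vertex to its parent, for a
    chosen root [c]. Carrying the depth [h] as data replaces any acyclicity
    argument about [p], and gives an induction principle. *)
Record rooted n (E : {set {set 'I_n}}) (c : 'I_n) (p : 'I_n -> 'I_n)
    (h : 'I_n -> nat) : Prop := Rooted {
  parent_root : p c = c;
  depth_root : h c = 0;
  depth_parent : forall x, x != c -> h x = (h (p x)).+1;
  edges_rooted : E = [set [set x; p x] | x in [set~ c]]
}.

Lemma set2_inj (V : finType) (a b x y : V) : [set a; b] = [set x; y] ->
  (a = x /\ b = y) \/ (a = y /\ b = x).
Proof.
move=> eqs.
have := set21 a b; have := set22 a b; rewrite eqs !inE.
have := set21 x y; have := set22 x y; rewrite -eqs !inE.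
by do 4![case/orP=> /eqP ?]; subst; auto.
Qed.

Definition branch (V : finType) (p : V -> V) (x : V) : {set V} :=
  [set y | fconnect p y x].

Lemma branch_step (V : finType) (p : V -> V) x y :
  (y \in branch p x) = (y == x) || (p y \in branch p x).
Proof. by rewrite !inE fconnect_eqVf. Qed.

Section Rooted.
Variables (n : nat) (E : {set {set 'I_n}}) (c : 'I_n).
Variables (p : 'I_n -> 'I_n) (h : 'I_n -> nat).
Hypothesis rE : rooted E c p h.
Implicit Types x y z : 'I_n.

Lemma depth_eq0 x : (h x == 0) = (x == c).
Proof.
have [->|xc] := eqVneq x c; first by rewrite (depth_root rE).
by rewrite (depth_parent rE xc).
Qed.

Lemma depth_ind (P : 'I_n -> Prop) :
  P c -> (forall x, x != c -> P (p x) -> P x) -> forall x, P x.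
Proof.
move=> Pc Pp x; have [k] := ubnP (h x); elim: k x => // k IHk x ltk.
have [->//|xc] := eqVneq x c; apply: Pp => //; apply: IHk.
by move: ltk; rewrite (depth_parent rE xc).
Qed.

Lemma mem_rooted x y :
  ([set x; y] \in E) = ((x != c) && (p x == y)) || ((y != c) && (p y == x)).
Proof.
rewrite (edges_rooted rE); apply/imsetP/idP => [[z]|].
  by rewrite !inE => zc /set2_inj[[-> ->]|[-> ->]]; rewrite zc eqxx ?orbT.
case/orP=> /andP[zc /eqP <-]; first by exists x; rewrite ?inE.
by exists y; rewrite ?inE // setUC.
Qed.

Lemma adj_rooted x y :
  adj E x y = ((x != c) && (p x == y)) || ((y != c) && (p y == x)).
Proof. exact: mem_rooted. Qed.

Lemma adj_parent x : x != c -> adj E x (p x).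
Proof. by move=> xc; rewrite adj_rooted xc eqxx. Qed.

Lemma depth_adj x y : adj E x y -> h x <= (h y).+1.
Proof.
by rewrite adj_rooted; case/orP=> /andP[zc /eqP <-]; rewrite (depth_parent rE zc) //; lia.
Qed.

Lemma parent_neq x : x != c -> p x != x.
Proof. by move=> xc; apply/eqP=> epx; have := depth_parent rE xc; rewrite epx; lia. Qed.

Lemma connect_root x : connect (adj E) x c.
Proof.
elim/depth_ind: x => [|x xc]; first exact: connect0.
exact/connect_trans/connect1/adj_parent.
Qed.

Lemma edge_parent_inj : {in [set~ c] &, injective (fun x => [set x; p x])}.
Proof.
move=> x y; rewrite !inE => xc yc /set2_inj[[]//|[xpy pxy]].
have := depth_parent rE xc; have := depth_parent rE yc.
by rewrite -xpy pxy; lia.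
Qed.

Lemma gdist_rooted x : gdist (adj E) x c = h x.
Proof.
have [] := @gdist_descent _ (adj E) h c _ x.
  by move=> y yc; exists (p y); [apply: adj_parent | apply: depth_parent rE _ _].
case/gdist_path=> q [eq lq <-] le_qh; apply/eqP; rewrite eqn_leq le_qh /=.
by have := path_potential depth_adj eq; rewrite lq (depth_root rE).
Qed.

(** On a cycle, both neighbours of a vertex of maximal depth would have to be its
    parent. *)
Lemma rooted_is_tree : is_tree E.
Proof.
apply/and3P; split.
- apply/forall_inP=> e; rewrite (edges_rooted rE) => /imsetP[x].
  by rewrite !inE => xc ->; rewrite cards2 [x == _]eq_sym parent_neq.
- apply/forallP=> x; apply/forallP=> y; apply: connect_trans (connect_root x) _.
  by rewrite (sym_connect_sym (adj_sym E)) connect_root.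
- apply/forallP=> k; apply/forallP=> q; apply/implyP=> ucq; rewrite leqNgt.
  rewrite -(size_tuple q); apply/negP=> lt2q.
  have [x xq maxx]: exists2 x, x \in tval q & forall y, y \in tval q -> h y <= h x.
    case: (tval q) lt2q => // a s _.
    case: (@arg_maxnP _ a (mem (a :: s)) h) => [|x xq maxx]; first exact: mem_head.
    by exists x.
  have [i s eqs] := rot_to xq.
  have mems y : y \in x :: s -> h y <= h x by rewrite -eqs mem_rot; apply: maxx.
  have up y : y \in x :: s -> adj E x y -> p x = y.
    move=> /mems le_y; rewrite adj_rooted => /orP[/andP[_ /eqP//]|/andP[yc /eqP pyx]].
    by have := depth_parent rE yc; rewrite pyx; lia.
  have : ucycleb (adj E) (x :: s) by rewrite -eqs /ucycleb rot_cycle rot_uniq.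
  have : 2 < size (x :: s) by rewrite -eqs size_rot.
  case: s {eqs mems} up => [|y s] // up; case/lastP: s up => [|s z] // up _.
  rewrite /ucycleb /= rcons_path last_rcons => /andP[/and3P[xy _ zx]].
  have pxy : p x = y by apply: up => //; rewrite !inE eqxx orbT.
  have pxz : p x = z.
    by apply: up; rewrite ?(adj_sym E x) // !inE mem_rcons !inE eqxx !orbT.
  by rewrite mem_rcons inE -pxy pxz eqxx /= andbF.
Qed.

Lemma branch_root x : (c \in branch p x) = (x == c).
Proof.
rewrite inE; apply/idP/eqP => [|->]; last exact: connect0.
by move/iter_findex <-; apply: iter_fix (parent_root rE).
Qed.

Lemma depth_branch x y : y \in branch p x -> h x <= h y.
Proof.
elim/depth_ind: y => [|y yc IHy]; first by rewrite branch_root => /eqP->.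
rewrite branch_step (depth_parent rE yc).
by case/orP=> [/eqP<-|/IHy]; [rewrite (depth_parent rE yc) | lia].
Qed.

(** The depth of [y] is its number of non-root ancestors, [y] included. *)
Lemma depth_sum y : h y = \sum_(x | x != c) (y \in branch p x).
Proof.
elim/depth_ind: y => [|y yc IHy].
  by rewrite (depth_root rE) big1 // => x xc; rewrite branch_root (negPf xc).
have pyF : p y \notin branch p y.
  by apply/negP=> /depth_branch; rewrite (depth_parent rE yc) ltnn.
rewrite (depth_parent rE yc) IHy !(bigD1 y yc) /= (negPf pyF) branch_step eqxx.
congr _.+1; apply: eq_bigr => x /andP[_ xy].
by rewrite [in RHS]branch_step eq_sym (negPf xy).
Qed.

(** A relation contains the climb from [y] to its ancestor [x] as soon as it contains
    the parent steps strictly below [x]. *)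
Lemma connect_climb (e : rel 'I_n) x y : y \in branch p x ->
  (forall z, z \in branch p x -> z != x -> e z (p z)) -> connect e y x.
Proof.
move=> yx ez; elim/depth_ind: y yx => [|y yc IHy].
  by rewrite branch_root => /eqP->; apply: connect0.
have [->|yx] := eqVneq y x; first by rewrite connect0.
move=> ybx; apply: connect_trans (connect1 (ez y ybx yx)) (IHy _).
by rewrite branch_step (negPf yx) in ybx.
Qed.

Lemma branch_top y : y != c -> exists x, [/\ x != c, p x = c & y \in branch p x].
Proof.
elim/depth_ind: y => [|y yc IHy _]; first by rewrite eqxx.
have [pyc|/IHy[x [xc px pyx]]] := eqVneq (p y) c.
  by exists y; rewrite branch_step eqxx.
by exists x; rewrite branch_step pyx orbT.
Qed.

(** Both sides count the pairs of a vertex and one of its non-root ancestors. *)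
Lemma sum_depth : \sum_(y | y != c) h y = \sum_(x | x != c) #|branch p x|.
Proof.
under eq_bigr do rewrite depth_sum.
rewrite exchange_big /=; apply: eq_bigr => x xc.
rewrite -sum1_card [RHS]big_mkcond [RHS](bigD1 c) //= branch_root (negPf xc) add0n.
by apply: eq_bigr => y _; case: ifP.
Qed.

Lemma card_branch_gt0 x : 0 < #|branch p x|.
Proof. by apply/card_gt0P; exists x; rewrite inE connect0. Qed.

Lemma card_branch_lt x : x != c -> #|branch p x| < n.
Proof.
move=> xc; rewrite -[X in _ < X]card_ord -cardsT proper_card // properT.
by apply: contraNneq xc => eT; rewrite -branch_root eT inE.
Qed.

Lemma depth_gt0 x : x != c -> 0 < h x.
Proof. by move=> xc; rewrite (depth_parent rE xc). Qed.

Lemma sum_depth_pred :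
  \sum_(y | y != c) (h y - 1) = \sum_(x | x != c) (#|branch p x| - 1).
Proof.
rewrite !sumnB ?sum_depth // => x xc; first exact: card_branch_gt0.
exact: depth_gt0.
Qed.

(** Every edge other than the deleted one has both ends inside or both ends outside
    the branch of [x]; conversely, parent steps lead from inside to [x] and from
    outside to [c]. *)
Lemma connect_cut x y z : x != c ->
  connect (adj (E :\ [set x; p x])) y z = ((y \in branch p x) == (z \in branch p x)).
Proof.
move=> xc; set e := adj _.
have e_sym : connect_sym e.
  by apply: sym_connect_sym => a b; rewrite /e /adj /= setUC.
have e_parent a : a != c -> a != x -> e a (p a).
  move=> ac ax; rewrite /e /adj /= in_setD1 mem_rooted ac eqxx /= andbT.
  by apply: contra ax => /eqP /edge_parent_inj ->; rewrite ?inE.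
apply/idP/eqP => [|eqyz].
  apply: closed_connect => a b.
  rewrite /e /adj /= in_setD1 => /andP[].
  have step d : d != c -> [set d; p d] != [set x; p x] ->
      (d \in branch p x) = (p d \in branch p x).
    move=> dc; rewrite [LHS]branch_step; have [-> /eqP//|//] := eqVneq d x.
  move=> nab; rewrite mem_rooted => /orP[]/andP[dc /eqP eqd].
    by have := step _ dc; rewrite eqd !inE => ->.
  by have := step _ dc; rewrite eqd !inE => -> //; rewrite setUC.
have to_x a : a \in branch p x -> connect e a x.
  move=> ax; apply: connect_climb => // b bx; apply: e_parent.
  by apply: contraTneq bx => ->; rewrite branch_root.
have to_c a : a \notin branch p x -> connect e a c.
  elim/depth_ind: a => [|a ac IHa]; first by rewrite connect0.
  rewrite branch_step negb_or => /andP[ax /IHa].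
  by apply: connect_trans; apply/connect1/e_parent.
have [yx|yx] := boolP (y \in branch p x).
  by apply: connect_trans (to_x y yx) _; rewrite e_sym to_x // -eqyz.
by apply: connect_trans (to_c y yx) _; rewrite e_sym to_c // -eqyz.
Qed.

End Rooted.

(** * [Phi], [Psi] and centroids in terms of branches *)

(** For the splitting lemmas on the minimum in [sigma]; the default value of that
    minimum is not a neutral element of [minn]. *)
HB.instance Definition _ := SemiGroup.isComLaw.Build nat minn minnA minnC.

Section RootedTree.
Variables (n : nat) (T : tree n).
Implicit Types c : 'I_n.

Lemma Phi_rooted c p h : rooted T c p h ->
  Phi c T = \sum_(x | x != c) (#|branch p x| - 1).
Proof.
move=> rT; rewrite -(sum_depth_pred rT); apply: eq_bigr => x _.
by rewrite (gdist_rooted rT).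
Qed.

Lemma sigma_rooted c p h x : rooted T c p h -> x != c ->
  sigma T [set x; p x] = minn #|branch p x| (n - #|branch p x|).
Proof.
move=> rT xc; set B := branch p x.
have cB : c \notin B by rewrite (branch_root rT).
have xB : x \in B by rewrite inE connect0.
have -> : n - #|B| = #|~: B| by rewrite [RHS]cardsCs card_ord setCK.
have nBC : B != ~: B by apply/eqP=> eB; move: (cB); rewrite eB in_setC cB.
rewrite /sigma.
have -> : components (adj (edges T :\ [set x; p x])) setT = [set B; ~: B].
  have blockE y : [set z in setT | connect [rel a b | [&& a \in setT, b \in setT &
      adj (edges T :\ [set x; p x]) a b]] y z] = if y \in B then B else ~: B.
    apply/setP=> z; rewrite in_set in_setT /=.
    rewrite (@eq_connect _ _ (adj (edges T :\ [set x; p x]))); last first.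
      by move=> a b; rewrite /= !inE.
    by rewrite (connect_cut rT) // -/B; case: (y \in B); rewrite ?in_setC eq_sym.
  apply/setP=> A; rewrite in_set2; apply/imsetP/orP => [[y _ ->]|].
    by rewrite blockE; case: ifP; rewrite eqxx; [left|right].
  case=> /eqP->; [exists x|exists c] => //; rewrite blockE ?xB //.
  by rewrite (negPf cB).
rewrite (bigD1 B) ?set21 //= (bigD1 (~: B)) ?set22 1?eq_sym //= big_pred0; last first.
  by move=> A; rewrite in_set2; case: (A == B) => //=; rewrite ?andbF ?andbT ?andbN.
by rewrite [minn _ n](minn_idPl _) // -[X in _ <= X]card_ord max_card.
Qed.

Lemma Psi_rooted c p h : rooted T c p h ->
  Psi T = \sum_(x | x != c) (minn #|branch p x| (n - #|branch p x|) - 1).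
Proof.
move=> rT; rewrite /Psi {1}(edges_rooted rT) big_imset /=; last exact: edge_parent_inj rT.
by apply: eq_big => x; rewrite !inE // => xc; rewrite (sigma_rooted rT).
Qed.

Lemma Psi_le_Phi c p h : rooted T c p h -> Psi T <= Phi c T.
Proof.
move=> rT; rewrite (Psi_rooted rT) (Phi_rooted rT); apply: leq_sum => x _; lia.
Qed.

(** [Psi T] is at most [Phi c T] term by term, so the reverse inequality forces all
    the minima in [Psi T] to be the sizes of the branches. *)
Lemma Phi_le_PsiP c p h : rooted T c p h ->
  reflect (forall x, x != c -> 2 * #|branch p x| <= n) (Phi c T <= Psi T).
Proof.
move=> rT; rewrite (Psi_rooted rT) (Phi_rooted rT); apply: (iffP idP) => [|le].
  have := @leqif_sum _ (fun x => x != c) (fun x => 2 * #|branch p x| <= n)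
     (fun x => minn #|branch p x| (n - #|branch p x|) - 1) (fun x => #|branch p x| - 1).
  case=> [x xc|le_Psi eq_sum le_Phi]; last first.
    by apply/forall_inP; rewrite -eq_sum eqn_leq le_Psi.
  have := card_branch_gt0 p x; have := card_branch_lt rT xc; move: #|_| => k; split; lia.
by apply: leq_sum => x /le; lia.
Qed.

(** The components of [T] without [c] are the branches of the children of [c], and
    these contain all other branches. *)
Lemma centroidP c p h : rooted T c p h ->
  reflect (forall x, x != c -> 2 * #|branch p x| <= n) (centroid T c).
Proof.
move=> rT; rewrite /centroid /components.
set e := [rel x y | _].
apply: (iffP forall_inP) => le => [x xc|A /imsetP[y]].
  have := le [set y in [set~ c] | connect e x y].
  rewrite imset_f ?inE // => /(_ isT); apply: leq_trans.
  rewrite leq_mul2l /=; apply/subset_leq_card/subsetP => y yx.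
  have neq_c a : a \in branch p x -> a != c.
    by apply: contraTneq => ->; rewrite (branch_root rT).
  rewrite !inE neq_c //= (@sym_connect_sym _ e); last first.
    by move=> a b; rewrite /e /= (adj_sym _ _ b) andbCA.
  apply: (connect_climb rT) => // z zx nzx.
  have zc := neq_c z zx; rewrite /e /= !inE zc (adj_parent rT) // andbT neq_c //.
  by rewrite branch_step (negPf nzx) in zx.
rewrite !inE => yc ->; have [x [xc pxc yx]] := branch_top rT yc.
apply: leq_trans (le x xc); rewrite leq_mul2l /=.
apply/subset_leq_card/subsetP => z; rewrite 2!inE => /andP[_ yz].
suff cl : closed e (branch p x) by rewrite -(closed_connect cl yz).
have step d : d != c -> p d != c -> (d \in branch p x) = (p d \in branch p x).
  move=> dc pdc; rewrite [LHS]branch_step; case: eqVneq => // edx.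
  by rewrite edx pxc eqxx in pdc.
move=> a b; rewrite /e /= !in_setC1 => /and3P[ac bc].
rewrite (adj_rooted rT) => /orP[]/andP[dc /eqP eqd].
  by rewrite -eqd -step // eqd.
by rewrite -eqd -step // eqd.
Qed.

(** Parents are the next vertices on shortest paths to [c]. An edge that
    joins no vertex to its parent would close a cycle with the path that the
    remaining edges provide between its ends. *)
Lemma tree_rooted c : exists p h, rooted T c p h.
Proof.
case: T => E /= tE; case/and3P: (tE) => sE cE aE.
have E_conn x y : connect (adj E) x y by have /forallP/(_ x)/forallP := cE.
pose h x := gdist (adj E) x c.
pose p x := if x == c then c else odflt c [pick y | adj E x y && (h x == (h y).+1)].
have pP x : x != c -> adj E x (p x) /\ h x = (h (p x)).+1.
  move=> xc; rewrite /p (negPf xc); case: pickP => [y /andP[? /eqP]//|no_y].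
  have [y exy hx] := gdist_step (E_conn x c) xc.
  by have := no_y y; rewrite exy /h hx eqxx.
have rE : rooted [set [set x; p x] | x in [set~ c]] c p h.
  split=> //; [by rewrite /p eqxx | exact: gdistxx | by move=> x /pP[]].
exists p, h; suff -> : E = [set [set x; p x] | x in [set~ c]] by [].
set F := [set _ | x in _] in rE *.
have subFE : F \subset E.
  by apply/subsetP=> d /imsetP[x]; rewrite !inE => /pP[xp _] ->.
apply/eqP; rewrite eqEsubset subFE andbT; apply/subsetP=> d dE; apply/idPn => dF.
have /cards2P[a [b [ab ed]]] := forall_inP sE d dE; subst d.
have: connect (adj F) a b.
  apply: connect_trans (connect_root rE a) _.
  by rewrite (sym_connect_sym (adj_sym F)) (connect_root rE).
case/connectP=> q0 /shortenP[q Fq Uq _] eb {q0}.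
have szq : size (a :: q) < n.+1.
  by have /card_uniqP <- := Uq; rewrite ltnS -[X in _ <= X]card_ord max_card.
have /forallP/(_ (Ordinal szq))/forallP/(_ (in_tuple (a :: q)))/implyP := aE.
rewrite /ucycleb Uq andbT /= rcons_path -eb.
have -> : path (adj E) a q.
  by apply: sub_path Fq => x y; apply: (subsetP subFE).
rewrite {1}/adj /= setUC dE => /(_ isT).
case: q {szq Uq} Fq eb => [|y [|z q]] //=; first by move=> _ eab; rewrite eab eqxx in ab.
by rewrite andbT {1}/adj /= => /[swap] <-; rewrite (negPf dF).
Qed.

End RootedTree.

(** * Leaf slides *)

Lemma Phi_depth n (T : tree n) c p h : rooted T c p h ->
  Phi c T = \sum_(x | x != c) (h x - 1).
Proof. by move=> rT; apply: eq_bigr => x _; rewrite (gdist_rooted rT). Qed.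

(** The truncated subtractions in [Phi] are exact, so comparing [Phi] at two roots
    amounts to comparing sums of distances. *)
Lemma Phi_total n (T : tree n) c : Phi c T + n.-1 = \sum_x gdist (adj T) x c.
Proof.
have [p [h rT]] := tree_rooted T c; rewrite (Phi_depth rT).
rewrite [RHS](bigD1 c) //= gdistxx add0n.
rewrite -[n in n.-1]card_ord -(cardC1 c) -sum1_card -big_split /=.
apply: eq_big => x; rewrite ?inE // => xc.
by rewrite (gdist_rooted rT) subnK ?(depth_gt0 rT).
Qed.

Lemma leaf_rooted n E (c : 'I_n) p h v : rooted E c p h -> v != c ->
  reflect (forall x, x != c -> p x != v) (leaf E v).
Proof.
move=> rE vc; apply: (iffP cards1P) => [[u /setP eqN] x xc|no_child].
  apply/eqP=> pxv.
  have eqxu : x = u by apply/eqP; rewrite -in_set1 -eqN inE (adj_rooted rE) xc pxv eqxx orbT.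
  have eqpu : p v = u by apply/eqP; rewrite -in_set1 -eqN inE (adj_parent rE).
  by have := depth_parent rE vc; have := depth_parent rE xc; rewrite pxv eqpu eqxu; lia.
exists (p v); apply/setP=> y; rewrite !inE (adj_rooted rE) vc eq_sym /=.
by have [->|yc] := eqVneq y c; rewrite ?orbF //= (negPf (no_child y yc)) orbF.
Qed.

Lemma rooted_slide n E (c : 'I_n) p h v w : rooted E c p h -> v != c ->
    (forall x, x != c -> p x != v) -> w != v ->
  rooted ([set v; w] |: (E :\ [set v; p v])) c
    (fun x => if x == v then w else p x) (fun x => if x == v then (h w).+1 else h x).
Proof.
move=> rE vc no_child wv; split.
- by rewrite eq_sym (negPf vc) (parent_root rE).
- by rewrite eq_sym (negPf vc) (depth_root rE).
- move=> x xc; have [_|_] := eqVneq x v; first by rewrite (negPf wv).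
  by rewrite (negPf (no_child x xc)) (depth_parent rE xc).
apply/setP=> d; rewrite !inE {1}(edges_rooted rE).
apply/orP/imsetP => [[/eqP->|/andP[dv /imsetP[x xc ed]]]|[x xc ->]].
- by exists v; rewrite ?inE ?eqxx.
- exists x => //; rewrite ed; case: eqVneq => // exv.
  by rewrite ed exv eqxx in dv.
have [->|xv] := eqVneq x v; [by left | right].
rewrite (imset_f (fun x => [set x; p x]) xc) andbT.
by apply: contra xv => /eqP /(edge_parent_inj rE xc) ->; rewrite // in_setC1.
Qed.

(** Only the depth of the slid leaf changes. The equation is additive since [h w] may
    lie on either side of [h (p v)]. *)
Lemma Phi_slide n (T1 T2 : tree n) c p h v w : rooted T1 c p h -> v != c ->
    (forall x, x != c -> p x != v) -> w != v ->
    edges T2 = [set v; w] |: (edges T1 :\ [set v; p v]) ->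
  Phi c T1 + h w = Phi c T2 + h (p v).
Proof.
move=> rT vc no_child wv eT2.
have := rooted_slide rT vc no_child wv; rewrite -eT2 => rT2.
rewrite (Phi_depth rT) (Phi_depth rT2) !(bigD1 v vc) /= eqxx (depth_parent rT vc).
have -> : \sum_(x | (x != c) && (x != v)) ((if x == v then (h w).+1 else h x) - 1)
   = \sum_(x | (x != c) && (x != v)) (h x - 1).
  by apply: eq_bigr => x /andP[_ /negPf->].
by rewrite !subn1 /=; lia.
Qed.

(** This is all that is needed about slides for lower bounds. Rooting at the slid leaf
    [v] is excluded: every distance from [v] may change at once. *)
Lemma leaf_slideP n (T1 T2 : tree n) : leaf_slide T1 T2 ->
  exists2 v, leaf T2 v & forall c, c != v -> Phi c T1 <= (Phi c T2).+1.
Proof.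
case/existsP=> v /existsP[u /existsP[w /and5P[lv avu auw wv /eqP eT2]]].
have slide c : c != v -> exists p h, [/\ rooted T1 c p h, v != c,
    forall x, x != c -> p x != v & p v = u].
  move=> cv; have [p [h rT]] := tree_rooted T1 c; exists p, h.
  have vc : v != c by rewrite eq_sym.
  have nv := leaf_rooted rT vc lv; split=> //.
  by move: avu; rewrite (adj_rooted rT) vc => /orP[/andP[_ /eqP]|/andP[/nv/negPf->]].
exists v => [|c /slide[p [h [rT vc nv pv]]]].
  have [p [h [rT vc nv pv]]] := slide w wv.
  have := rooted_slide rT vc nv wv; rewrite pv -eT2 => rT2.
  apply/(leaf_rooted rT2 vc) => x /nv; by case: ifP.
have:= Phi_slide rT vc nv wv; rewrite pv => /(_ T2 eT2).
by have := depth_adj rT auw; lia.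
Qed.

(** The branch of the only neighbour of a leaf [v] holds the [n - 1] other vertices,
    which is more than half of them. *)
Lemma leaf_Psi_lt_Phi n (T : tree n) v : 2 < n -> leaf T v -> Psi T < Phi v T.
Proof.
move=> n2 /cards1P[u /setP eqN]; have [p [h rT]] := tree_rooted T v.
rewrite ltnNge; apply/negP=> /(Phi_le_PsiP rT) le.
have top y : y != v -> y \in branch p u.
  case/(branch_top rT)=> x [xv px yx].
  by have := eqN x; rewrite !inE (adj_rooted rT) xv px eqxx orbT => /esym/eqP<-; rewrite inE in yx.
have uv : u != v.
  have := eqN u; rewrite !inE eqxx (adj_rooted rT).
  by apply: contraTneq => ->; rewrite eqxx.
have : #|[set~ v]| <= #|branch p u|.
  by apply/subset_leq_card/subsetP=> y; rewrite in_setC1; apply: top.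
by rewrite cardsC1 card_ord; have := le u uv; lia.
Qed.

(** For a minimiser [c] of [Phi], take a child [t] whose branch [B] contains that of
    [x]. Passing from [c] to [t] shortens by one the distance to the vertices in
    [B] and lengthens the others by at most one; minimality bounds [#|B|]. *)
Lemma exists_Phi_le_Psi n (T : tree n) (c0 : 'I_n) : exists c, Phi c T <= Psi T.
Proof.
case: (@arg_minnP _ c0 predT (fun c => Phi c T)) => // c _ minc; exists c.
have [p [h rT]] := tree_rooted T c; apply/(Phi_le_PsiP rT) => x xc.
have [t [tc ptc xt]] := branch_top rT xc; set B := branch p t.
have xB : #|branch p x| <= #|B|.
  apply/subset_leq_card/subsetP=> y; rewrite !inE in xt *.
  by move=> yx; apply: connect_trans yx xt.
pose f y := if y \in B then h y - 1 else (h y).+1.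
have tB : t \in B by rewrite inE connect0.
have cB : c \notin B by rewrite (branch_root rT).
have le_f y : gdist (adj T) y t <= f y.
  have [] // := @gdist_descent _ (adj T) f t _ y; move=> {}y yt.
  have [eyc|yc] := eqVneq y c.
    exists t; first by rewrite eyc (adj_rooted rT) tc ptc eqxx orbT.
    by rewrite /f eyc (negPf cB) tB (depth_root rT) (depth_parent rT tc) ptc (depth_root rT).
  exists (p y); first exact: adj_parent rT _ yc.
  have eB : (y \in B) = (p y \in B) by rewrite branch_step (negPf yt).
  rewrite /f eB (depth_parent rT yc); case: ifP => // pyB.
  have : p y != c by apply: contraTneq pyB => ->.
  by move/(depth_gt0 rT); lia.
have sum_f : \sum_y f y + 2 * #|B| = \sum_y gdist (adj T) y c + n.
  rewrite -[X in _ = _ + X]card_ord -!sum1_card big_distrr /= [X in _ + X = _]big_mkcond /=.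
  rewrite -!big_split /=; apply: eq_bigr => y _; rewrite (gdist_rooted rT) /f.
  case: ifP => yB; last by lia.
  have : y != c by apply: contraTneq yB => ->.
  by move/(depth_gt0 rT); lia.
have := minc t isT; have := Phi_total T t; have := Phi_total T c.
have : \sum_y gdist (adj T) y t <= \sum_y f y by apply: leq_sum.
lia.
Qed.

(** A centroid [c] of [T2] gives [Psi T1 <= Phi c T1 <= Phi c T2 + 1 = Psi T2 + 1]. *)
Lemma Psi_slide n (T1 T2 : tree n) : 2 < n -> leaf_slide T1 T2 -> Psi T1 <= (Psi T2).+1.
Proof.
move=> n2 /leaf_slideP[v lv slide]; have [c le_c] := exists_Phi_le_Psi T2 v.
have [p [h rT]] := tree_rooted T1 c.
suff /slide : c != v by have := Psi_le_Phi rT; lia.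
by apply: contraTneq le_c => ->; rewrite -ltnNge leaf_Psi_lt_Phi.
Qed.

(** * Distance to the stars *)

Lemma star_rooted n (c : 'I_n) : rooted (star c) c (fun=> c) (fun x => x != c).
Proof.
split=> //; [by rewrite eqxx | by move=> x ->; rewrite eqxx |].
by apply: eq_imset => x; rewrite setUC.
Qed.

Lemma Phi_star n (c : 'I_n) : Phi c (star c) = 0.
Proof. by rewrite (Phi_depth (star_rooted c)) big1 // => x ->. Qed.

(** Slide a deepest vertex, which is a leaf, to its grandparent; this exists unless
    all depths are at most one. *)
Lemma toward_star n (T : tree n) c : T != star c ->
  exists2 T', leaf_slide T T' & Phi c T = (Phi c T').+1.
Proof.
have [p [h rT]] := tree_rooted T c => neqT.
case: (@arg_maxnP _ c predT h) => // v _ maxv.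
have hv : 1 < h v.
  rewrite ltnNge; apply: contra neqT => le1; apply/eqP/val_inj => /=.
  rewrite (edges_rooted rT); apply: eq_in_imset => x; rewrite in_setC1 => xc.
  suff /eqP-> : p x == c by rewrite setUC.
  by rewrite -(depth_eq0 rT); have := maxv x isT; rewrite /= (depth_parent rT xc); lia.
have vc : v != c by rewrite -(depth_eq0 rT); lia.
have hpv := depth_parent rT vc.
have uc : p v != c by rewrite -(depth_eq0 rT); lia.
have hw := depth_parent rT uc; set w := p (p v) in hw.
have wv : w != v by apply/eqP=> ewv; rewrite ewv in hw; lia.
have nv x : x != c -> p x != v.
  move=> xc; apply/eqP=> pxv; have := maxv x isT.
  by rewrite /= (depth_parent rT xc) pxv; lia.
pose T' := Tree (rooted_is_tree (rooted_slide rT vc nv wv)); exists T'.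
  apply/existsP; exists v; apply/existsP; exists (p v); apply/existsP; exists w.
  by rewrite (introT (leaf_rooted rT vc) nv) !(adj_parent rT) //= wv eqxx.
have := Phi_slide rT vc nv wv (T2 := T') erefl; lia.
Qed.

Lemma gdist_star_le_Phi n (T : tree n) c :
  connect (@leaf_slide n) T (star c) /\ gdist (@leaf_slide n) T (star c) <= Phi c T.
Proof. by apply: gdist_descent T => T; apply: toward_star. Qed.

Lemma Psi_le_gdist_star n (T : tree n) c : 2 < n ->
  Psi T <= gdist (@leaf_slide n) T (star c).
Proof.
move=> n2; have [/gdist_path[s [es ls <-]] _] := gdist_star_le_Phi T c.
have := path_potential (fun T1 T2 => @Psi_slide n T1 T2 n2) es; rewrite ls.
by have := Psi_le_Phi (star_rooted c); rewrite Phi_star; lia.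
Qed.

(** By induction [Phi c T' <= size s <= Psi T'] for the next tree [T'], so [c] is not
    a leaf of [T'], in particular not the vertex slid by the first step. *)
Lemma Phi_le_short_path n (T : tree n) c s : 2 < n ->
    path (@leaf_slide n) T s -> last T s = star c -> size s <= Psi T ->
  Phi c T <= size s.
Proof.
move=> n2; elim: s T => [|T' s IHs] T /=; first by move=> _ -> _; rewrite Phi_star.
case/andP=> TT' es ls le_s; have := Psi_slide n2 TT'.
move=> le_Psi; have le_s' : size s <= Psi T' by lia.
have le_Phi := IHs T' es ls le_s'.
have [v lv slide] := leaf_slideP TT'.
have cv : c != v.
  by apply: contraTneq lv => ecv; apply/negP=> /(leaf_Psi_lt_Phi n2); rewrite -ecv; lia.
by have := slide c cv; lia.
Qed.

Theorem proposition3p14 (n : nat) (hn : 3 <= n) (T : tree n) (c : 'I_n) :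
  [<-> centroid T c;
       Psi T = gdist (@leaf_slide n) T (star c) /\
         gdist (@leaf_slide n) T (star c) = Phi c T;
       forall c' : 'I_n,
         gdist (@leaf_slide n) T (star c) <= gdist (@leaf_slide n) T (star c')].
Proof.
have [p [h rT]] := tree_rooted T c.
have [conn le_Phi] := gdist_star_le_Phi T c; have le_Psi := Psi_le_gdist_star T c hn.
tfae.
- by move/(centroidP rT)/(Phi_le_PsiP rT); lia.
- by case=> <- _ c'; apply: Psi_le_gdist_star.
- move=> minc; apply/(centroidP rT)/(Phi_le_PsiP rT).
  have [c' le_c'] := exists_Phi_le_Psi T c; have [_ le_c'Phi] := gdist_star_le_Phi T c'.
  have [s [es ls szs]] := gdist_path conn.
  have le_s : size s <= Psi T by have := minc c'; lia.
  exact: leq_trans (Phi_le_short_path hn es ls le_s) le_s.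
Qed.
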